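(* Let $\mathbb{X},\tilde{\mathbb{X}}$ be metrizable topological spaces with their Borel $\sigma$-algebras, and let $\mathbb{Y}$ be a measurable space whose $\sigma$-algebra is countably generated and contains all singletons. Let $f\colon\mathbb{X}\to\tilde{\mathbb{X}}$ and $g\colon\tilde{\mathbb{X}}\to\mathbb{Y}$ be measurable maps and $h=g\circ f$. Let $\mu$ be a $\sigma$-finite Radon measure on $\mathbb{X}$ such that $h_\star\mu$ is $\sigma$-finite and $f_\star\mu$ is a $\sigma$-finite Radon measure on $\tilde{\mathbb{X}}$. Then, for $h_\star\mu$-almost every $y\in\mathbb{Y}$, $$(f_\star\mu)^g(\,\cdot\mid y)=f_\star\bigl(\mu^h(\,\cdot\mid y)\bigr).$$
   Context: Disintegration: given a measurable map $h\colon\mathbb{X}\to\mathbb{Y}$ and a measure $\mu$ on $\mathbb{X}$, a disintegration of $\mu$ with respect to $h$ is a map $(A,y)\mapsto\mu^h(A\mid y)\in[0,\infty]$ such that $\mu^h(\,\cdot\mid y)$ is a measure on $\mathbb{X}$ for all $y\in\mathbb{Y}$, $y\mapsto\mu^h(A\mid y)$ is measurable for every measurable $A\subset\mathbb{X}$, (i) $\mu^h(\mathbb{X}\setminus h^{-1}(\{y\})\mid y)=0$, and (ii) $\mu(A)=\int_{\mathbb{Y}}\mu^h(A\mid y)\,h_\star\mu(dy)$ for every measurable $A$, where $h_\star\mu$ is the pushforward. When $\mathbb{X}$ is metrizable with Borel $\sigma$-algebra, $\mu$ is $\sigma$-finite Radon, $h_\star\mu$ is $\sigma$-finite, and the $\sigma$-algebra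 of $\mathbb{Y}$ is countably generated and contains singletons, it exists and is unique up to $h_\star\mu$-null sets of $y$. *)

(* Defs.v *)
From HB Require Import structures.
From mathcomp Require Import all_boot all_order all_algebra.
From mathcomp Require Import all_classical all_reals all_analysis.

Set Implicit Arguments.
Unset Strict Implicit.
Unset Printing Implicit Defensive.

Import Order.TTheory GRing.Theory Num.Theory.

Local Open Scope classical_set_scope.
Local Open Scope ring_scope.
Local Open Scope ereal_scope.

Notation borelType T := (g_sigma_algebraType (@open T)).

Definition metrizable (R : realType) (T : topologicalType) : Prop :=
  exists dist : T -> T -> R,
    [/\ forall x y, (0 <= dist x y)%R,
        forall x y, dist x y = 0%R <-> x = y,
        forall x y, dist x y = dist y x,
        forall x y z, (dist x z <= dist x y + dist y z)%R
      & forall U : set T, open U <->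
          forall x, U x ->
            exists2 e : R, (0 < e)%R & [set y | (dist x y < e)%R] `<=` U].

Definition countably_generated d (Y : measurableType d) : Prop :=
  exists2 G : set (set Y), countable G & (@measurable d Y) = <<s G >>.

(* Inner regularity is required on all Borel sets.  In a metrizable space it
   makes finiteness on compact sets equivalent to local finiteness. *)
Definition radon (R : realType) (T : ptopologicalType)
    (mu : set (borelType T) -> \bar R) : Prop :=
  (forall K : set T, compact K -> mu K < +oo) /\
  (forall A : set (borelType T), measurable A ->
    mu A = ereal_sup [set mu K | K in [set K : set T | compact K /\ K `<=` A]]).

(* [k y A] is written mu^h(A | y) in the literature.  The type of [k] states
   that each [k y] is a measure and that [k ^~ A] is measurable for every
   measurable [A]; the total mass of [k y] may be infinite. *)
Definition disintegration d d' (X : measurableType d) (Y : measurableType d')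
    (R : realType) (mu : set X -> \bar R) (h : X -> Y)
    (k : R.-ker Y ~> X) : Prop :=
  (forall y, k y (~` (h @^-1` [set y])) = 0) /\
  (forall A, measurable A -> mu A = \int[pushforward mu h]_y k y A).

(* Main.v *)
(** The kernels [fmu_g] and [y |-> f_*(mu_h y)] both disintegrate
    [nu = f_*mu] along [g], so the theorem is a uniqueness statement.  Since
    [k y] lives on the fibre [g^-1 {y}], the mass [nu (A /\ g^-1 B)] is the
    integral over [B] of [k y A]; hence the values of two disintegrations on a
    fixed [A] of finite [nu]-mass agree for almost every [y].  To make the null
    set independent of [A], note that [nu], being Radon and sigma-finite, is
    carried by countably many compact sets [K n] of finite mass.  Each [K n] is
    second countable, so its Borel sets are generated by a countable family of
    traces closed under intersection, on which the two finite measures agree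
    for almost every [y]; they are then equal by the pi-lambda theorem. *)

Require Import Defs.
From HB Require Import structures.
From mathcomp Require Import all_boot all_order all_algebra.
From mathcomp Require Import all_classical all_reals all_analysis.
From mathcomp Require Import measurable_realfun.

Set Implicit Arguments.
Unset Strict Implicit.
Unset Printing Implicit Defensive.

Import Order.TTheory GRing.Theory Num.Theory.

Local Open Scope classical_set_scope.
Local Open Scope ring_scope.
Local Open Scope ereal_scope.

(** * Balls and compact sets in metrizable spaces *)

Lemma metrizable_open_balls (R : realType) (T : topologicalType) :
  metrizable R T -> exists dist : T -> T -> R,
    [/\ forall x y, dist x y = 0%R <-> x = y,
        forall x y, (0 <= dist x y)%R,
        forall x y, dist x y = dist y x,
        forall x y z, (dist x z <= dist x y + dist y z)%R &
        (forall x (e : R), open [set y | (dist x y < e)%R]) /\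
        (forall (V : set T) x, open V -> V x ->
          exists2 e : R, (0 < e)%R & [set y | (dist x y < e)%R] `<=` V)].
Proof.
case=> dist [d_ge0 d0 dC dtri dopen]; exists dist; split => //; split.
  move=> x e; apply/dopen => w /= xw.
  exists (e - dist x w)%R; first by rewrite subr_gt0.
  by move=> v /=; rewrite ltrBrDl; apply: le_lt_trans.
by move=> V x /dopen; apply.
Qed.

Lemma metrizable_hausdorff (R : realType) (T : topologicalType) :
  metrizable R T -> hausdorff_space T.
Proof.
move=> /metrizable_open_balls[dist [d0 d_ge0 dC dtri [oball _]]].
rewrite open_hausdorff => x y xy.
have dxy : (0 < dist x y)%R.
  by rewrite lt_neqAle d_ge0 andbT eq_sym; apply: contra xy => /eqP/d0/eqP.
have e0 : (0 < dist x y / 2)%R by rewrite divr_gt0.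
exists ([set w | (dist x w < dist x y / 2)%R],
        [set w | (dist y w < dist x y / 2)%R]); split => //=.
- by apply/mem_set => /=; rewrite (d0 x x).2.
- by apply/mem_set => /=; rewrite (d0 y y).2.
apply/eqP/seteqP; split => // z [/= xz yz].
have := dtri x z y; rewrite (dC z y) leNgt => /negP; apply.
by rewrite [ltRHS](splitr (dist x y)) ltrD.
Qed.

(** For each [n], compactness covers [K] by finitely many balls of radius [1/(n+1)], and [U]
    enumerates these balls over all [n]. They are open in [T] but serve as a base only at the points
    of [K]. *)
Lemma compact_metrizable_countable_base (R : realType) (T : ptopologicalType)
    (K : set T) : metrizable R T -> compact K ->
  exists U : nat -> set T, (forall n, open (U n)) /\
    forall (V : set T) x, open V -> K x -> V x ->
      exists n, U n x /\ U n `<=` V.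
Proof.
move=> /metrizable_open_balls[dist [d0 _ dC dtri [oball ball_sub]]].
rewrite compact_cover => cK.
pose B (z : T) (n : nat) := [set w | (dist z w < n.+1%:R^-1)%R].
have /choice[s sK] (n : nat) : exists s : seq T, forall x, K x ->
    exists2 z, z \in s & B z n x.
  have [|x Kx|D _ KD] := cK T setT (B ^~ n).
  - by move=> z _; exact: oball.
  - by exists x => //=; rewrite /B/= (d0 x x).2// invr_gt0.
  - by exists (finmap.enum_fset D) => x /KD[z /= zD zx]; exists z.
(* The index codes a radius and a position in the corresponding net; the default values [point] and
   [set0] still yield open sets. *)
pose U i := if unpickle i is Some (n, j) then B (nth point (s n) j) n
            else set0.
exists U; split.
  move=> i; rewrite /U; case: unpickle => [[n j]|]; [exact: oball|exact: open0].
move=> V x oV Kx Vx; have [e e0 eV] := ball_sub V x oV Vx.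
(* Points of a ball of radius below [e / 2] are less than [e] apart, so a net ball containing [x]
   lies in [V]. *)
have /ltr_add_invr[n] : (0 < e / 2)%R by rewrite divr_gt0.
rewrite add0r => ne.
have [z zs zx] := sK n x Kx.
exists (pickle (n, index z (s n))); rewrite /U pickleK nth_index//; split => //.
move=> w /= zw; apply: eV => /=; apply: le_lt_trans (dtri x z w) _.
by rewrite (splitr e) ltrD// ?(lt_trans _ ne)// dC.
Qed.

(** * Borel measures and compact sets *)

Lemma compact_borel (R : realType) (T : ptopologicalType) (K : set T) :
  metrizable R T -> compact K -> measurable (K : set (borelType T)).
Proof.
move=> mT cK.
have oK : measurable (~` K : set (borelType T)).
  apply: sub_sigma_algebra; apply: closed_openC.
  exact: compact_closed (metrizable_hausdorff mT) cK.
by rewrite -(setCK K); exact: measurableC.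
Qed.

(** The traces on [K] of finite intersections of the [U i] form a pi-system generating the Borel
    sets of [K]. Indexing by sequences keeps it countable, and the empty sequence gives [K]
    itself. *)
Lemma borel_measure_unique_trace (R : realType) (T : ptopologicalType)
    (K : set (borelType T)) (U : nat -> set T)
    (m1 m2 : {measure set (borelType T) -> \bar R}) :
  measurable K -> (forall n, open (U n)) ->
  (forall (V : set T) x, open V -> K x -> V x ->
    exists n, U n x /\ U n `<=` V) ->
  m1 K < +oo ->
  (forall s : seq nat, let A := K `&` \bigcap_(i in [set` s]) U i in
    m1 A = m2 A) ->
  forall A : set (borelType T), measurable A -> m1 (A `&` K) = m2 (A `&` K).
Proof.
move=> mK oU baseU K_fin m12 A mA.
have mU n : measurable (U n : set (borelType T)) by exact: sub_sigma_algebra.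
pose G : set (set (borelType T)) :=
  [set K `&` \bigcap_(i in [set` s]) U i | s in [set: seq nat]].
pose H := [set X | G X /\ X `<=` K].
have GH (s : seq nat) : H (K `&` \bigcap_(i in [set` s]) U i).
  by split; [exists s|exact: subIsetl].
have sK : <<s K, H >> `<=` [set X | X `<=` K].
  apply: smallest_sub => [|Z [] //].
  split => // [Z ZK|F FK]; first exact: subDsetl.
  by apply: bigcup_sub => n _; exact: FK.
have HI : setI_closed H.
  move=> _ _ [[s _ <-] _] [[t _ <-] _].
  suff -> : K `&` \bigcap_(i in [set` s]) U i `&`
      (K `&` \bigcap_(i in [set` t]) U i) =
      K `&` \bigcap_(i in [set` s ++ t]) U i by exact: GH.
  apply/seteqP; split => x.
    move=> [[Kx sx] [_ tx]]; split => // i /=; rewrite mem_cat => /orP[].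
      exact: sx.
    exact: tx.
  move=> [Kx Ux]; split; split => // i /= ist; apply: Ux => /=;
    by rewrite mem_cat ist ?orbT.
apply: (g_sigma_algebra_measure_unique_trace G K) => //.
- move=> _ [[s _ <-] _]; apply: measurableI => //.
  exact: bigcap_measurableType.
- by have /= := m12 [::]; rewrite set_nil bigcap_set0 setIT.
- by move=> _ [[s _ <-] _]; exact: m12.
have [s0 sD sU] := smallest_sigma_algebra K H.
(* The sets whose trace on [K] is generated by [H] form a sigma-algebra, so it is enough that it
   contains the open sets. *)
suff : @measurable _ (borelType T) `<=` [set X | <<s K, H >> (X `&` K)].
  exact.
apply: smallest_sub => /= [|V oV].
  split => [|X XK|F FK].
  - by rewrite /= set0I.
  - rewrite /= (_ : _ `&` K = K `\` (X `&` K)); first exact: sD.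
    by rewrite setTD setDIr setDv setU0 setIC setDE.
  - by rewrite /= setI_bigcupl; apply: sU.
(* By [baseU], the open set [V] coincides on [K] with the union of those [U n] that it contains. *)
rewrite /= (_ : V `&` K =
    \bigcup_n (if `[<U n `<=` V>] then U n `&` K else set0)); last first.
  apply/seteqP; split => x.
    move=> [Vx Kx]; have [n [Unx UnV]] := baseU V x oV Kx Vx.
    by exists n => //; rewrite asboolT.
  by move=> [n _]; case: asboolP => // UnV [/UnV].
apply: sU => n; case: asboolP => _ //.
apply: sub_gen_smallest; have := GH [:: n].
by rewrite set_cons1 bigcap_set1 setIC.
Qed.

(** Up to a null set, [A] is the disjoint union of its pieces in [seqDU K n], each inside [K n];
    countable additivity sums the equalities, even when the masses are infinite. *)
Lemma measure_unique_glue d (T : measurableType d) (R : realType)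
    (K : nat -> set T) (m1 m2 : {measure set T -> \bar R}) :
  (forall n, measurable (K n)) ->
  m1 (~` \bigcup_n K n) = 0 -> m2 (~` \bigcup_n K n) = 0 ->
  (forall n A, measurable A -> m1 (A `&` K n) = m2 (A `&` K n)) ->
  forall A, measurable A -> m1 A = m2 A.
Proof.
move=> mK m1K m2K m12 A mA.
have mS : measurable (\bigcup_n K n) by exact: bigcupT_measurable.
have mD n : measurable (seqDU K n) by exact: seqDU_measurable.
suff E (m : {measure set T -> \bar R}) : m (~` \bigcup_n K n) = 0 ->
    (* The last intersection leaves the set unchanged and puts it in the form that [m12] expects. *)
    m A = \sum_(0 <= n <oo | n \in setT) m (A `&` seqDU K n `&` K n).
  rewrite (E m1)// (E m2)//; apply: eq_eseriesr => n _.
  by apply: m12; exact: measurableI.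
move=> mC.
rewrite [LHS](measureDI m mA mS) [X in X + _](_ : _ = 0) ?add0e; last first.
  apply: (subset_measure0 _ _ _ mC); [exact: measurableD|exact: measurableC|].
  by move=> x [].
rewrite seqDU_bigcup_eq setI_bigcupr.
transitivity (\sum_(0 <= n <oo | n \in setT) m (A `&` seqDU K n)).
  apply: measure_bigcup => [n _|]; first exact: measurableI.
  exact/trivIset_setIl/trivIset_seqDU.
apply: eq_eseriesr => n _; congr (m _).
by rewrite -setIA; congr (_ `&` _); apply/esym/setIidl; exact: subset_seqDU.
Qed.

(** Since [mu A] is finite, inner regularity gives compact sets [K n] inside [A] whose complements
    in [A] have mass below [1/(n+1)]. *)
Lemma radon_inner_compacts (R : realType) (T : ptopologicalType)
    (mu : {measure set (borelType T) -> \bar R}) (A : set (borelType T)) :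
  metrizable R T -> radon mu -> measurable A -> mu A < +oo ->
  exists K : nat -> set T, (forall n, compact (K n)) /\
    mu (A `\` \bigcup_n K n) = 0.
Proof.
move=> mT [_ mu_inner] mA A_fin.
have Afin : mu A \is a fin_num by rewrite ge0_fin_numE.
have /choice[K HK] (n : nat) : exists K : set T,
    [/\ compact K, K `<=` A & mu A - n.+1%:R^-1%:E < mu K].
  have e0 : (0 < n.+1%:R^-1 :> R)%R by rewrite invr_gt0.
  have := @ub_ereal_sup_adherent R _ _ e0.
  move=> /(_ [set mu K | K in [set K : set T | compact K /\ K `<=` A]]).
  rewrite -mu_inner// => /(_ Afin)[_ [K [cK KA] <-] KAn].
  by exists K.
exists K; split; first by move=> n; have [] := HK n.
have mK n : measurable (K n : set (borelType T)).
  by apply: (compact_borel mT); have [] := HK n.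
have mS : measurable (\bigcup_n K n : set (borelType T)).
  exact: bigcupT_measurable.
apply/eqP; rewrite eq_le measure_ge0 andbT; apply/lee_addgt0Pr => e e0.
rewrite add0e.
have [n] := ltr_add_invr e0; rewrite add0r => ne.
have [_ KA AK] := HK n.
apply: (@le_trans _ _ (mu (A `\` K n))).
  apply: le_measure; rewrite ?inE; [exact: measurableD|exact: measurableD|].
  by apply: setDS; exact: bigcup_sup.
rewrite measureD// setIidr//.
rewrite leeBlDr; last first.
  by rewrite ge0_fin_numE// (le_lt_trans _ A_fin)// le_measure ?inE.
move: AK; rewrite lteBlDr// => /ltW/le_trans; apply.
by rewrite addeC leeD2r// lee_fin ltW.
Qed.

(** Each piece [F n] of finite mass is exhausted by compact sets; a coding of pairs merges these
    sequences into one. *)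
Lemma radon_sigma_finite_compacts (R : realType) (T : ptopologicalType)
    (mu : {measure set (borelType T) -> \bar R}) :
  metrizable R T -> radon mu -> sigma_finite [set: borelType T] mu ->
  exists K : nat -> set T, (forall n, compact (K n)) /\
    mu (~` \bigcup_n K n) = 0.
Proof.
move=> mT mu_radon [F FT F_fin].
have /choice[K HK] (n : nat) : exists K : nat -> set T,
    (forall m, compact (K m)) /\ mu (F n `\` \bigcup_m K m) = 0.
  by have [mF muF] := F_fin n; exact: radon_inner_compacts.
pose C i := if unpickle i is Some (n, m) then K n m else set0.
have cC i : compact (C i).
  rewrite /C; case: unpickle => [[n m]|]; last exact: compact0.
  by have [] := HK n.
exists C; split => //.
have mC i : measurable (C i : set (borelType T)) by exact: compact_borel mT _.
have mK n : measurable (\bigcup_m K n m : set (borelType T)).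
  apply: bigcupT_measurable => m.
  by apply: compact_borel mT _; have [] := HK n.
apply/eqP; rewrite -measure_le0.
apply: (@le_trans _ _ (\sum_(0 <= n <oo) mu (F n `\` \bigcup_m K n m))).
  apply: measure_sigma_subadditive.
  - by move=> n; apply: measurableD => //; have [] := F_fin n.
  - by apply: measurableC; exact: bigcupT_measurable.
  move=> x Cx; have : [set: borelType T] x by [].
  rewrite FT => -[n _ Fx]; exists n => //; split => // -[m _ Kx].
  by apply: Cx; exists (pickle (n, m)) => //; rewrite /C pickleK.
by rewrite eseries0// => n _ _; have [] := HK n.
Qed.

(** * Uniqueness of disintegrations *)

Definition mpushforward d d' (X : measurableType d) (Y : measurableType d')
    (R : realType) (mu : {measure set X -> \bar R}) (f : {mfun X >-> Y}) :
  {measure set Y -> \bar R}.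
Proof.
refine (pushforward mu f : {measure set Y -> \bar R}).
exact: measurable_funPT.
(* Kept transparent so that conversion identifies this measure with [pushforward mu f]. *)
Defined.

(** The fibre over [y], which carries [k y], lies inside the preimage of [B] or misses it, according
    to whether [y] is in [B]. *)
Lemma disintegration_setI d d' (X : measurableType d) (Y : measurableType d')
    (R : realType) (mu : {measure set X -> \bar R}) (h : {mfun X >-> Y})
    (k : R.-ker Y ~> X) (A : set X) (B : set Y) :
  (forall y : Y, measurable [set y]) -> disintegration mu h k ->
  measurable A -> measurable B ->
  mu (A `&` h @^-1` B) = \int[pushforward mu h]_(y in B) k y A.
Proof.
move=> Y1 [k_fiber k_int] mA mB.
have mpre C : measurable C -> measurable (h @^-1` C).
  by move=> mC; rewrite -[X in measurable X]setTI; exact: measurable_funPT.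
rewrite k_int; last by apply: measurableI => //; exact: mpre.
rewrite [RHS]integral_mkcond; congr (integral _ _ _).
apply/funext => y; rewrite patchE.
have null C : measurable C -> C `<=` ~` (h @^-1` [set y]) -> k y C = 0.
  move=> mC Cy; apply: subset_measure0 (k_fiber y) => //.
  exact/measurableC/mpre.
case: ifPn => [/set_mem By|/negP yB].
  rewrite [RHS](measureDI _ mA (mpre _ mB)) [X in X + _]null ?add0e//.
  - by apply: measurableD => //; exact: mpre.
  - by move=> x [_ /= hx] hxy; apply: hx; rewrite hxy.
rewrite null//; first by apply: measurableI => //; exact: mpre.
by move=> x [_ /= hx] hxy; apply: yB; apply/mem_set; rewrite -hxy.
Qed.

(** Both functions of [y] have the same integral over every measurable [E], namely the mass of [A]
    above [E]; finiteness of [mu A] makes them integrable. *)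
Lemma disintegration_ae_eq d d' (X : measurableType d) (Y : measurableType d')
    (R : realType) (mu : {measure set X -> \bar R}) (h : {mfun X >-> Y})
    (k1 k2 : R.-ker Y ~> X) (A : set X) :
  (forall y : Y, measurable [set y]) ->
  disintegration mu h k1 -> disintegration mu h k2 ->
  measurable A -> mu A < +oo ->
  {ae pushforward mu h, forall y, k1 y A = k2 y A}.
Proof.
move=> Y1 dis1 dis2 mA A_fin.
pose P := mpushforward mu h.
suff : ae_eq P setT (k1 ^~ A) (k2 ^~ A) by apply: filterS => y; apply.
apply: integral_ae_eq => //.
- apply/integrableP; split; first exact: measurable_kernel.
  rewrite (eq_integral (k1 ^~ A)); first by rewrite -(dis1.2 A mA).
  by move=> y _; rewrite gee0_abs.
- exact: measurable_kernel.
- by move=> E _ mE; rewrite -!disintegration_setI.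
Qed.

Lemma disintegration_unique (R : realType) (T : ptopologicalType)
    (d : measure_display) (Y : measurableType d)
    (mu : {measure set (borelType T) -> \bar R})
    (h : {mfun borelType T >-> Y}) (k1 k2 : R.-ker Y ~> borelType T) :
  metrizable R T -> (forall y : Y, measurable [set y]) ->
  sigma_finite [set: borelType T] mu -> radon mu ->
  disintegration mu h k1 -> disintegration mu h k2 ->
  {ae pushforward mu h, forall y,
    forall A : set (borelType T), measurable A -> k1 y A = k2 y A}.
Proof.
move=> mT Y1 mu_sf mu_radon dis1 dis2.
have [K [cK K_full]] := radon_sigma_finite_compacts mT mu_radon mu_sf.
have mK n : measurable (K n : set (borelType T)) by exact: compact_borel mT _.
have K_fin n : mu (K n) < +oo by exact: mu_radon.1.
have mCK : measurable (~` \bigcup_n K n : set (borelType T)).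
  by apply: measurableC; exact: bigcupT_measurable.
have /choice[U HU] n := compact_metrizable_countable_base mT (cK n).
have mU n i : measurable (U n i : set (borelType T)).
  by apply: sub_sigma_algebra; exact: (HU n).1.
pose P := mpushforward mu h.
have PF : Filter (almost_everywhere (pushforward mu h)).
  exact: (ae_filter_ringOfSetsType P).
have null (k : R.-ker Y ~> borelType T) : disintegration mu h k ->
    {ae P, forall y, k y (~` \bigcup_n K n) = 0}.
  move=> dis.
  have : ae_eq P setT (k ^~ (~` \bigcup_n K n)) (cst 0).
    apply/ae_eq_integral_abs => //; first exact: measurable_kernel.
    under eq_integral do rewrite gee0_abs//.
    by rewrite -(dis.2 _ mCK).
  by apply: filterS => y; apply.
have agree : {ae P, forall y, forall n (s : seq nat),
    k1 y (K n `&` \bigcap_(i in [set` s]) U n i) =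
    k2 y (K n `&` \bigcap_(i in [set` s]) U n i)}.
  (* Sequences are coded by natural numbers so that [ae_foralln] applies; [set0] stands in for
     non-codes, where both measures vanish. *)
  have all_ns n : {ae P, forall y, forall i,
      let A := if @unpickle (seq nat) i is Some s
               then K n `&` \bigcap_(j in [set` s]) U n j else set0 in
      k1 y A = k2 y A}.
    apply: ae_foralln => i.
    case: (@unpickle (seq nat) i) => [s|] /=.
      have mB : measurable (K n `&` \bigcap_(j in [set` s]) U n j
          : set (borelType T)).
        by apply: measurableI => //; exact: bigcap_measurableType.
      apply: (disintegration_ae_eq Y1 dis1 dis2) => //.
      by rewrite (le_lt_trans _ (K_fin n))// le_measure ?inE.
    by apply: nearW => y; rewrite !measure0.
  have := ae_foralln all_ns; apply: filterS => y yns n s.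
  by have := yns n (pickle s); rewrite pickleK.
(* The integral of [k1 y (K n)] over [y] is [mu (K n)], finite because [K n] is compact. *)
have finite : {ae P, forall y, forall n, k1 y (K n) < +oo}.
  apply: ae_foralln => n.
  have : P.-integrable setT (k1 ^~ (K n)).
    apply/integrableP; split; first exact: measurable_kernel.
    under eq_integral do rewrite gee0_abs//.
    by rewrite -(dis1.2 _ (mK n)).
  move=> /(integrable_ae measurableT); apply: filterS => y /(_ I).
  by rewrite ge0_fin_numE.
apply: (filterS3 _ _ (null _ dis1) (null _ dis2) (filterI agree finite)).
move=> y y1 y2 [y_agree y_fin].
apply: (measure_unique_glue mK y1 y2) => n A mA.
have [oU baseU] := HU n.
exact: (borel_measure_unique_trace (mK n) oU baseU (y_fin n) (y_agree n)).
Qed.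

(** * Images of kernels under a measurable map *)

Definition kpushforward d d1 d2 (Y : measurableType d) (X : measurableType d1)
    (Z : measurableType d2) (R : realType) (k : R.-ker Y ~> X)
    (f : {mfun X >-> Z}) (y : Y) : {measure set Z -> \bar R} :=
  mpushforward (k y) f.

Lemma measurable_kpushforward d d1 d2 (Y : measurableType d)
    (X : measurableType d1) (Z : measurableType d2) (R : realType)
    (k : R.-ker Y ~> X) (f : {mfun X >-> Z}) (A : set Z) :
  measurable A -> measurable_fun [set: Y] (kpushforward k f ^~ A : Y -> \bar R).
Proof.
move=> mA; apply: measurable_kernel.
by rewrite -[X in measurable X]setTI; exact: measurable_funPT.
Qed.

HB.instance Definition _ d d1 d2 (Y : measurableType d) (X : measurableType d1)
    (Z : measurableType d2) (R : realType) (k : R.-ker Y ~> X)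
    (f : {mfun X >-> Z}) :=
  isKernel.Build _ _ _ _ _ (kpushforward k f)
    (@measurable_kpushforward _ _ _ _ _ _ _ k f).

(** Both conditions are those of [k] read on preimages under [f], because preimages under [g \o f]
    are iterated preimages. *)
Lemma disintegration_kpushforward d d1 d2 (Y : measurableType d)
    (X : measurableType d1) (Z : measurableType d2) (R : realType)
    (mu : {measure set X -> \bar R}) (f : {mfun X >-> Z})
    (g : Z -> Y) (k : R.-ker Y ~> X) :
  disintegration mu (g \o f) k ->
  disintegration (pushforward mu f) g (kpushforward k f).
Proof.
move=> [k_fiber k_int]; split => [y|A mA]; first exact: k_fiber.
by apply: k_int; rewrite -[X in measurable X]setTI; exact: measurable_funPT.
Qed.

Theorem lemma2p8 (R : realType) (X Xt : ptopologicalType)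
    (d : measure_display) (Y : measurableType d)
    (X_metrizable : metrizable R X) (Xt_metrizable : metrizable R Xt)
    (Y_countably_generated : countably_generated Y)
    (Y_singletons : forall y : Y, measurable [set y])
    (f : {mfun borelType X >-> borelType Xt}) (g : {mfun borelType Xt >-> Y})
    (mu : {measure set (borelType X) -> \bar R})
    (mu_sigma_finite : sigma_finite [set: borelType X] mu)
    (mu_radon : radon mu)
    (hmu_sigma_finite : sigma_finite [set: Y] (pushforward mu (g \o f)))
    (fmu_sigma_finite : sigma_finite [set: borelType Xt] (pushforward mu f))
    (fmu_radon : radon (pushforward mu f))
    (mu_h : R.-ker Y ~> borelType X)
    (mu_h_disintegration : disintegration mu (g \o f) mu_h)
    (fmu_g : R.-ker Y ~> borelType Xt)
    (fmu_g_disintegration : disintegration (pushforward mu f) g fmu_g) :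
  {ae pushforward mu (g \o f), forall y : Y,
    forall A : set (borelType Xt), measurable A ->
      fmu_g y A = pushforward (mu_h y) f A}.
Proof.
(* Pushing [mu] forward by [f] and then by [g] is convertible with pushing it forward by [g \o f],
   so the null sets are the ones required. *)
exact: (@disintegration_unique R Xt d Y (mpushforward mu f) g fmu_g
  (kpushforward mu_h f) Xt_metrizable Y_singletons fmu_sigma_finite fmu_radon
  fmu_g_disintegration (disintegration_kpushforward mu_h_disintegration)).
Qed.
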